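(* Let $\mathfrak{q}=(t_1^{b_1},\ldots,t_r^{b_r})$ be an irreducible monomial ideal of $S=K[t_1,\ldots,t_s]$, with $b_i\geq 1$ for all $i$. The following conditions are equivalent. (a) $\mathfrak{q}$ is normal. (b) $\mathfrak{q}$ is complete. (c) $\mathfrak{q}=(t_1,\ldots,t_{j-1},t_j^{b_j},t_{j+1},\ldots,t_r)$ for some $j$, that is, $b_i=1$ for $i\in\{1,\ldots,r\}\setminus\{j\}$.
   Context: $S$ is a polynomial ring over a field $K$, $1\leq r\leq s$, and the $b_i$ are positive integers. $\overline{L}$ is the integral closure of an ideal $L$. A monomial ideal $L$ is complete if $L=\overline{L}$, and normal if $L^n$ is complete for all $n\geq 1$. *)

(* Defs.v *)
From mathcomp Require Import all_boot all_order all_algebra.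
From mathcomp Require Import classical_sets.
From mathcomp Require Import mpoly.

Set Implicit Arguments.
Unset Strict Implicit.
Unset Printing Implicit Defensive.

Import GRing.Theory.
Local Open Scope ring_scope.
Local Open Scope classical_set_scope.

Definition ideal_gen (R : comNzRingType) (G : set R) : set R :=
  [set x | exists (m : nat) (c g : 'I_m -> R),
     (forall i, G (g i)) /\ x = \sum_(i < m) c i * g i].

(* For n = 0 the only generator is the empty product 1, so L^0 = R. *)
Definition ideal_exp (R : comNzRingType) (L : set R) (n : nat) : set R :=
  ideal_gen [set x | exists f : 'I_n -> R,
     (forall i, L (f i)) /\ x = \prod_(i < n) f i].

(* z^n + a_1 z^(n-1) + ... + a_n = 0 with n >= 1 and a_i in L^i. *)
Definition integral_closure (R : comNzRingType) (L : set R) : set R :=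
  [set z | exists (n : nat) (a : nat -> R),
     [/\ (0 < n)%N,
         forall i, (1 <= i <= n)%N -> ideal_exp L i (a i)
       & z ^+ n + \sum_(1 <= i < n.+1) a i * z ^+ (n - i) = 0]].

Definition complete_ideal (R : comNzRingType) (L : set R) : Prop :=
  L = integral_closure L.

Definition normal_ideal (R : comNzRingType) (L : set R) : Prop :=
  forall n, (1 <= n)%N -> complete_ideal (ideal_exp L n).

(* (t_1^(b_1), ..., t_r^(b_r)) in K[t_1, ..., t_s], where t_i is the
   variable of index i - 1. *)
Definition var_pow_ideal (K : fieldType) (s r : nat) (hrs : (r <= s)%N)
    (b : 'I_r -> nat) : set {mpoly K[s]} :=
  ideal_gen (range (fun i : 'I_r => 'X_(widen_ord hrs i) ^+ b i)).

(* Main.v *)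
Require Import Defs.
From HB Require Import structures.
From mathcomp Require Import all_boot all_order all_algebra.
From mathcomp Require Import classical_sets.
From mathcomp Require Import mpoly.
From mathcomp Require Import boolp zify.

(** Everything rests on a degree function that is additive on products.

    If all exponents but [b j] are 1, give [t_j] the weight 1, the other
    variables among the first [r] the weight [d = b j], and the remaining
    variables the weight 0. Each generator then has weight [d], and a monomial
    of weight at least [d] is a multiple of one of them; by induction,
    [q ^ n] is spanned by the monomials of weight at least [d * n]
    ([monomial_in_exp], [weight_ge_ideal_exp]). The least weight of a monomial
    of [f] is the order at [X = 0] of [f (t_i X ^ w_i)], hence a valuation,
    because [X] is prime in [K[t][X]]. In an equation of integral dependence
    over [q ^ n], an element of order less than [d * n] would have a first term
    of strictly smaller order than all the others, so the ideal
    of elements of order at least [d * n] is integrally closed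
    ([weight_ge_integrally_closed]).

    Conversely, if [b i] and [b j] are both at least 2, with [i] and [j]
    distinct, then [z = t_i ^ (b i - 1) * t_j ^ (b j - 1)] is not in [q], as no
    generator divides it, while [z ^ 2] is a multiple of
    [t_i ^ b i * t_j ^ b j], so that [z] is integral over [q]
    ([complete_exponents]). A complete [q] hence has at most one exponent
    different from 1. *)

Set Implicit Arguments.
Unset Strict Implicit.
Unset Printing Implicit Defensive.

Import GRing.Theory.
Local Open Scope ring_scope.

(** * Ideals, their powers and integral elements *)

Section IdealPowers.

Variable R : comNzRingType.
Implicit Types (L G P : set R) (x y z : R).

(** The induction principle of [ideal_gen]: a set stable under addition that
    contains the multiples of the generators contains the ideal. *)
Lemma ideal_gen_sub G P :
  P 0 -> (forall x y, P x -> P y -> P (x + y)) ->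
  (forall c x, G x -> P (c * x)) -> forall x, ideal_gen G x -> P x.
Proof.
move=> P0 PD PM _ [m [c [g [Gg ->]]]].
by elim/big_ind: _ => // i _; exact: PM.
Qed.

Lemma ideal_gen0 G : ideal_gen G 0.
Proof.
by exists 0, (fun=> 0), (fun=> 0); split; [case | rewrite big_ord0].
Qed.

Lemma ideal_gen_mul G c x : G x -> ideal_gen G (c * x).
Proof.
by move=> Gx; exists 1, (fun=> c), (fun=> x); split; rewrite ?big_ord1.
Qed.

Lemma ideal_genD G x y : ideal_gen G x -> ideal_gen G y -> ideal_gen G (x + y).
Proof.
move=> [m [c [g [Gg ->]]]] [n [d [h [Gh ->]]]].
pose join (f1 : 'I_m -> R) (f2 : 'I_n -> R) k :=
  match split k with inl i => f1 i | inr i => f2 i end.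
have joinl f1 f2 i : join f1 f2 (lshift n i) = f1 i.
  by rewrite /join (unsplitK (inl i)).
have joinr f1 f2 i : join f1 f2 (rshift m i) = f2 i.
  by rewrite /join (unsplitK (inr i)).
exists (m + n)%N, (join c d), (join g h); split.
  by move=> k; rewrite /join; case: split.
rewrite big_split_ord /=.
by congr (_ + _); apply: eq_bigr => i _; rewrite ?joinl ?joinr.
Qed.

Lemma ideal_genM G c x : ideal_gen G x -> ideal_gen G (c * x).
Proof.
apply: (ideal_gen_sub (P := [set x | ideal_gen G (c * x)])) => /=.
- by rewrite mulr0; exact: ideal_gen0.
- by move=> y z Gy Gz; rewrite mulrDr; exact: ideal_genD.
- by move=> d y Gy; rewrite mulrA; exact: ideal_gen_mul.
Qed.

Lemma ideal_gen_sum G (I : eqType) (r : seq I) (F : I -> R) :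
  (forall i, i \in r -> ideal_gen G (F i)) -> ideal_gen G (\sum_(i <- r) F i).
Proof.
move=> GF; rewrite big_seq; elim/big_ind: _ => //.
  exact: ideal_gen0.
exact: ideal_genD.
Qed.

Lemma ideal_exp0 L x : ideal_exp L 0 x.
Proof.
rewrite -[x]mulr1; apply: ideal_gen_mul.
by exists (fun=> 1); split; [case | rewrite big_ord0].
Qed.

(** Membership in [L ^ n] is always obtained by peeling off one factor in [L]
    at a time; the cofactor may be any element of [L ^ n], not only a product
    of generators. *)
Lemma ideal_expS L n x y :
  L x -> ideal_exp L n y -> ideal_exp L n.+1 (x * y).
Proof.
move=> Lx; apply: (ideal_gen_sub (P := [set y | ideal_exp L n.+1 (x * y)])).
- by rewrite /= mulr0; exact: ideal_gen0.
- by move=> u v /= Gu Gv; rewrite mulrDr; exact: ideal_genD.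
- move=> c _ [f [Lf ->]] /=; rewrite mulrCA; apply: ideal_gen_mul.
  exists (fun i => if unlift ord0 i is Some k then f k else x); split.
    by move=> i; case: unliftP.
  rewrite big_ord_recl unlift_none; congr (_ * _).
  by apply: eq_bigr => i _; rewrite liftK.
Qed.

Lemma ideal_exp1 G : ideal_exp (ideal_gen G) 1 = ideal_gen G.
Proof.
apply/seteqP; split => x.
  apply: ideal_gen_sub; [exact: ideal_gen0 | exact: ideal_genD |].
  by move=> c _ [f [Gf ->]]; rewrite big_ord1; exact: ideal_genM.
by move=> Gx; rewrite -[x]mulr1; apply: ideal_expS => //; exact: ideal_exp0.
Qed.

(** The equation of integral dependence is [Z ^ n - z ^ n = 0]. *)
Lemma integral_root L n z :
  (0 < n)%N -> ideal_exp L n (z ^+ n) -> integral_closure L z.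
Proof.
move=> n0 Lz; exists n, (fun i => if i == n then - z ^+ n else 0); split=> //.
  move=> i _; case: eqP => [-> | _]; last exact: ideal_gen0.
  by rewrite -mulN1r; exact: ideal_genM.
rewrite big_nat_recr //= eqxx subnn mulr1 big_nat big1 ?add0r ?subrr //.
by move=> i /andP[_ lt_in]; rewrite ltn_eqF // mul0r.
Qed.

Lemma sub_integral_closure L z : L z -> integral_closure L z.
Proof.
move=> Lz; apply: (@integral_root _ 1) => //.
by rewrite expr1 -[z]mulr1; apply: ideal_expS => //; exact: ideal_exp0.
Qed.

End IdealPowers.

(** * The order of a polynomial for a weight on the variables *)

Section WeightFiltration.

Variables (K : fieldType) (s : nat) (w : 'I_s -> nat).
Implicit Types (f g : {mpoly K[s]}) (m : 'X_{1..s}).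

Definition weight m : nat := (\sum_i w i * m i)%N.

(** The substitution of [t_i X ^ w_i] for [t_i]: the coefficient of [X ^ k] in
    the image of [f] is the part of [f] of weight [k]. As this is a ring
    morphism, statements about least weights become statements about
    divisibility by powers of [X]. *)
Definition weight_grading : {mpoly K[s]} -> {poly {mpoly K[s]}} :=
  mmap (polyC \o @mpolyC s K) (fun i => ('X_i)%:P * 'X^(w i)).
HB.instance Definition _ := GRing.RMorphism.on weight_grading.

Lemma weight_gradingX m : weight_grading 'X_[m] = ('X_[m])%:P * 'X^(weight m).
Proof.
rewrite /weight_grading mmapX /mmap1.
under eq_bigr do rewrite exprMn -rmorphXn -exprM.
rewrite big_split /= -rmorph_prod /= -mpolyXE_id; congr (_ * _).
by rewrite /weight expr_sum.
Qed.

Lemma weight_gradingZ c f :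
  weight_grading (c *: f) = (c%:MP)%:P * weight_grading f.
Proof. exact: mmapZ. Qed.

Lemma coef_weight_grading f k m :
  ((weight_grading f)`_k)@_m = f@_m *+ (weight m == k).
Proof.
have wX n : ((weight_grading (f@_n *: 'X_[n]))`_k)@_m =
   f@_n * (n == m)%:R *+ (weight m == k).
  rewrite weight_gradingZ weight_gradingX mulrA -rmorphM /=.
  rewrite coefCM coefXn mulr_natr mcoeffMn mcoeffCM mcoeffX [k == _]eq_sym.
  by have [->|_] := eqVneq n m; rewrite ?(mulr0, mul0rn).
have -> : f@_m = \sum_(n <- msupp f) f@_n * (n == m)%:R.
  rewrite {1}(mpolyE f) raddf_sum /=.
  by apply: eq_bigr => n _; rewrite mcoeffZ mcoeffX.
rewrite [in LHS](mpolyE f) raddf_sum /= coef_sum raddf_sum /= -sumrMnl.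
by apply: eq_bigr.
Qed.

(** Stated by divisibility rather than on the support, so that sums and
    products are immediate. *)
Definition weight_ge d : set {mpoly K[s]} :=
  [set f | exists u, weight_grading f = 'X^d * u].

Lemma weight_ge_lep d e f : (e <= d)%N -> weight_ge d f -> weight_ge e f.
Proof.
move=> le_ed [u fE]; exists ('X^(d - e) * u).
by rewrite mulrA -exprD subnKC.
Qed.

Lemma weight_geP d f :
  weight_ge d f -> forall m, m \in msupp f -> (d <= weight m)%N.
Proof.
move=> [u fE] m; rewrite mcoeff_msupp; apply: contraR; rewrite -ltnNge => lt_md.
have := coef_weight_grading f (weight m) m.
by rewrite eqxx mulr1n fE mulrC coefMXn lt_md mcoeff0 => <-.
Qed.

Lemma weight_ge_prod n d (f : 'I_n -> {mpoly K[s]}) :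
  (forall i, weight_ge d (f i)) -> weight_ge (d * n) (\prod_(i < n) f i).
Proof.
elim: n f => [|n IHn] f fd.
  by exists 1; rewrite big_ord0 muln0 expr0 mulr1 rmorph1.
have [u fE] := fd ord0; have [v IHE] := IHn _ (fun i => fd (lift ord0 i)).
exists (u * v); rewrite big_ord_recl rmorphM /= fE IHE.
by rewrite mulrACA -exprD mulnS.
Qed.

Lemma weight_ge_ideal_gen d G :
  (forall f, G f -> weight_ge d f) ->
  forall f, ideal_gen G f -> weight_ge d f.
Proof.
move=> Gd; apply: ideal_gen_sub.
- by exists 0; rewrite rmorph0 mulr0.
- by move=> f g [u fE] [v gE]; exists (u + v); rewrite rmorphD /= fE gE mulrDr.
- move=> c f /Gd[u fE]; exists (weight_grading c * u).
  by rewrite rmorphM /= fE mulrCA.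
Qed.

Lemma weight_ge_ideal_exp d n L :
  (forall f, L f -> weight_ge d f) ->
  forall f, ideal_exp L n f -> weight_ge (d * n) f.
Proof.
move=> Ld; apply: weight_ge_ideal_gen => _ [f [Lf ->]].
by apply: weight_ge_prod => i; exact/Ld/Lf.
Qed.

(** The cofactor [u] carries the part of [f] of least weight as its constant
    term. *)
Lemma grading_order f : f != 0 ->
  exists v u, weight_grading f = 'X^v * u /\ ~~ root u 0.
Proof.
move=> f0; have gf0 : weight_grading f != 0.
  apply: contra f0 => /eqP gf0; apply/eqP/mpolyP => m.
  have := coef_weight_grading f (weight m) m.
  by rewrite gf0 coef0 eqxx mulr1n !mcoeff0.
have [v [u]] := multiplicity_XsubC (weight_grading f) 0.
by rewrite gf0 subr0 /= => nr ->; exists v, u; rewrite mulrC.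
Qed.

(** Valuation argument: let [v] be the order of [z] and suppose [v < d]. The
    [i]-th term of the equation has order at least [d * i + v * (n - i)], which
    exceeds [v * n] for [i > 0], so [X] divides the [n]-th power of the
    cofactor of [X ^ v] in the image of [z], contradicting the choice of [v]. *)
Lemma weight_ge_integrally_closed d L :
  (forall f, L f -> weight_ge d f) ->
  forall z, integral_closure L z -> weight_ge d z.
Proof.
move=> Ld z [n [a [n0 La zE]]].
have [->|/grading_order[v [u [gz nz]]]] := eqVneq z 0.
  by exists 0; rewrite rmorph0 mulr0.
have [le_dv|lt_vd] := leqP d v.
  by apply: (weight_ge_lep le_dv); exists u.
have [x gsum] : exists x, weight_grading
    (\sum_(1 <= i < n.+1) a i * z ^+ (n - i)) = 'X^((v * n).+1) * x.
  rewrite big_nat; elim/big_ind: _ => [|x y [p pE] [q qE]|i lt_i].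
  - by exists 0; rewrite rmorph0 mulr0.
  - by exists (p + q); rewrite rmorphD /= pE qE mulrDr.
  - have [x ax] := weight_ge_ideal_exp Ld (La i lt_i).
    have le_e : ((v * n).+1 <= d * i + v * (n - i))%N by nia.
    exists ('X^(d * i + v * (n - i) - (v * n).+1) * (x * u ^+ (n - i))).
    rewrite rmorphM rmorphXn /= ax gz exprMn -exprM mulrACA -exprD.
    by rewrite [RHS]mulrA -exprD subnKC.
have /(congr1 weight_grading) := zE.
rewrite rmorph0 rmorphD rmorphXn /= gz gsum exprMn -exprM exprSr -mulrA -mulrDr.
(* Cancel [X ^ (v * n)], then evaluate at [X = 0]. *)
move/eqP; rewrite mulf_eq0 expf_eq0 polyX_eq0 andbF /=.
move=> /eqP /(congr1 (horner^~ 0)) /eqP.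
by rewrite !hornerE expf_eq0 n0 /= -rootE (negPf nz).
Qed.

End WeightFiltration.

Lemma weightD (s : nat) (w : 'I_s -> nat) (m1 m2 : 'X_{1..s}) :
  weight w (m1 + m2)%MM = (weight w m1 + weight w m2)%N.
Proof.
by rewrite /weight -big_split; apply: eq_bigr => i _; rewrite mnmDE mulnDr.
Qed.

Lemma weight_pow_var (s : nat) (w : 'I_s -> nat) i e :
  weight w (U_(i) *+ e)%MM = (w i * e)%N.
Proof.
rewrite /weight (bigD1 i) //= big1 ?addn0 => [|k ne].
  by rewrite mulmnE mnm1E eqxx mul1n.
by rewrite mulmnE mnm1E eq_sym (negPf ne) muln0.
Qed.

(** * Ideals generated by powers of variables *)

Section PowersOfVariables.

Variables (K : fieldType) (s r : nat) (hrs : (r <= s)%N).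
Implicit Types (b : 'I_r -> nat) (i j : 'I_r).

Let var i : 'I_s := widen_ord hrs i.
Let q b : set {mpoly K[s]} := var_pow_ideal hrs b.

Lemma var_eq i j : (var i == var j) = (i == j).
Proof. by []. Qed.

Lemma pow_var_in b i e : (b i <= e)%N -> q b ('X_(var i) ^+ e).
Proof.
move=> le_be; rewrite -(subnK le_be) exprD; apply: ideal_gen_mul.
by exists i.
Qed.

(** A monomial that occurs in a combination of monomials is a multiple of one of
    them. *)
Lemma var_pow_ideal_msupp b f m :
  q b f -> m \in msupp f -> exists i, (b i <= m (var i))%N.
Proof.
move=> qf; move: m; move: f qf.
apply: (ideal_gen_sub (P := [set f : {mpoly K[s]} | forall m, m \in msupp f ->
  exists i, (b i <= m (var i))%N])) => [m|f g Pf Pg m|c _ [i _ <-] m].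
- by rewrite msupp0.
- by move=> /msuppD_le; rewrite mem_cat => /orP[/Pf|/Pg].
- rewrite mpolyXn (perm_mem (msuppMX _ _)) => /mapP[k _ ->]; exists i.
  by rewrite mnmDE mulmnE mnm1E eqxx mul1n leq_addr.
Qed.

Lemma var_pow_idealX b m :
  q b 'X_[m] -> exists i, (b i <= m (var i))%N.
Proof. by move/var_pow_ideal_msupp; apply; rewrite msuppX mem_seq1. Qed.

(** The product [t_i ^ (b i - 1) * t_j ^ (b j - 1)] would be integral over the
    ideal without belonging to it. *)
Lemma complete_exponents b i j :
  (forall k, (0 < b k)%N) -> complete_ideal (q b) -> i != j ->
  (b i <= 1)%N || (b j <= 1)%N.
Proof.
move=> b_gt0 cq ne_ij; apply/negPn; rewrite negb_or -!ltnNge.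
apply/negP => /andP[bi bj].
pose m := (U_(var i) *+ (b i).-1 + U_(var j) *+ (b j).-1)%MM.
have mE k : m (var k) = ((i == k) * (b i).-1 + (j == k) * (b j).-1)%N.
  by rewrite mnmDE !mulmnE !mnm1E !var_eq.
have : ~ q b 'X_[m].
  move=> /var_pow_idealX[k]; rewrite mE.
  have [<-|_] := eqVneq i k.
    by rewrite [j == i]eq_sym (negPf ne_ij); lia.
  by have := b_gt0 k; have [<-|_] := eqVneq j k; lia.
rewrite cq; apply; apply: (@integral_root _ _ 2) => //.
(* As [b i >= 2], the exponent [2 * (b i - 1)] is at least [b i]. *)
rewrite mpolyXD exprMn -!mpolyXn -!exprM.
rewrite -[_ * _]mulr1 -mulrA; apply: ideal_expS.
  by apply: pow_var_in; lia.
apply: ideal_expS; first by apply: pow_var_in; lia.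
exact: ideal_exp0.
Qed.

(** The exponents are determined by the ideal: [t_i] lies in it only if a
    generator divides [t_i], which forces [b i = 1]. *)
Lemma var_pow_ideal_eqP b j : (forall i, (1 <= b i)%N) ->
  q b = q (fun i => if i == j then b j else 1%N) <->
  (forall i, i != j -> b i = 1%N).
Proof.
move=> b_gt0; split=> [qE i ne_ij | b1]; last first.
  by congr q; apply/funext => i; case: eqVneq => [->|/b1].
have: q b ('X_(var i) ^+ 1).
  by rewrite qE; apply: pow_var_in; rewrite (negPf ne_ij).
rewrite expr1 => /var_pow_idealX[k]; rewrite mnm1E var_eq.
by have := b_gt0 k; case: (eqVneq i k) => [<-|_] /=; lia.
Qed.

(** * Normality when at most one exponent differs from 1 *)

Section Normality.

Variables (b : 'I_r -> nat) (j : 'I_r).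
Hypothesis b1 : forall i, i != j -> b i = 1%N.

(** Chosen so that every generator has the same weight [b j]: [t_j] itself must
    then have weight 1. *)
Definition one_power_weight (k : 'I_s) : nat :=
  if k == var j then 1%N else if (k < r)%N then b j else 0%N.

Let w := one_power_weight.

Lemma one_power_weight_gen i : (w (var i) * b i = b j)%N.
Proof.
rewrite /w /one_power_weight var_eq /= ltn_ord.
by have [->|/b1->] := eqVneq i j; rewrite ?mul1n ?muln1.
Qed.

(** Such a monomial involves none of the variables of weight [b j], and its
    weight is its exponent of [t_j]. *)
Lemma weight_lt_of_indivisible (m : 'X_{1..s}) :
  (forall i, (m (var i) < b i)%N) -> (weight w m < b j)%N.
Proof.
move=> lt_mb; rewrite /weight (bigD1 (var j)) //= big1 => [|k ne_kj].
  by rewrite addn0 /w /one_power_weight eqxx mul1n.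
rewrite /w /one_power_weight (negPf ne_kj); case: ifP => // lt_kr.
have kE : k = var (Ordinal lt_kr) by exact/val_inj.
have ne : Ordinal lt_kr != j by rewrite -var_eq -kE.
have := lt_mb (Ordinal lt_kr); rewrite -kE (b1 ne).
by case: (m k) => // _; rewrite muln0.
Qed.

(** A monomial of weight at least [b j] is divisible by a generator, and the
    quotient has lost exactly the weight [b j]; induct on [n]. *)
Lemma monomial_in_exp n m :
  (b j * n <= weight w m)%N -> ideal_exp (q b) n 'X_[m].
Proof.
elim: n m => [|n IHn] m le_m; first exact: ideal_exp0.
have [/existsP[i le_bm]|/existsPn lt_mb] :=
    boolP [exists i, (b i <= m (var i))%N]; last first.
  have lt_m : (weight w m < b j)%N.
    by apply: weight_lt_of_indivisible => i; rewrite ltnNge.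
  by nia.
have le_e : (U_(var i) *+ b i <= m)%MM.
  apply/mnm_lepP => k; rewrite mulmnE mnm1E.
  by have [<-|_] := eqVneq (var i) k; rewrite ?mul1n.
move: le_m; rewrite -(submK le_e) addmC weightD weight_pow_var.
rewrite one_power_weight_gen mulnS leq_add2l => le_m.
rewrite mpolyXD -mpolyXn; apply: ideal_expS; last exact: IHn.
exact: pow_var_in.
Qed.

Lemma one_power_normal : normal_ideal (q b).
Proof.
move=> n _; apply/seteqP; split=> z; first exact: sub_integral_closure.
have q_ge f : q b f -> weight_ge w (b j) f.
  apply: weight_ge_ideal_gen => _ [i _ <-].
  exists ('X_(var i) ^+ b i)%:P.
  rewrite mpolyXn weight_gradingX weight_pow_var one_power_weight_gen.
  exact: mulrC.
move/(weight_ge_integrally_closed (weight_ge_ideal_exp q_ge))/weight_geP => zw.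
rewrite [z]mpolyE; apply: ideal_gen_sum => m /zw le_m.
by rewrite -mul_mpolyC; apply/ideal_genM/monomial_in_exp.
Qed.

End Normality.

End PowersOfVariables.

Theorem proposition7p5 (K : fieldType) (s r : nat) (hr : (1 <= r)%N)
    (hrs : (r <= s)%N) (b : 'I_r -> nat) (hb : forall i, (1 <= b i)%N) :
  let q : set {mpoly K[s]} := var_pow_ideal hrs b in
  let qc (j : 'I_r) : set {mpoly K[s]} :=
    var_pow_ideal hrs (fun i => if i == j then b j else 1%N) in
  [<-> normal_ideal q; complete_ideal q; exists j : 'I_r, q = qc j]
  /\ (forall j : 'I_r, q = qc j <-> (forall i : 'I_r, i != j -> b i = 1%N)).
Proof.
move=> q qc.
have qP j : q = qc j <-> (forall i, i != j -> b i = 1%N).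
  exact: var_pow_ideal_eqP.
split=> //; tfae=> [nq | cq | [j /qP b1]].
- by have := nq 1%N isT; rewrite ideal_exp1.
- have [/existsP[j bj]|/existsPn b_le1] := boolP [exists j, (1 < b j)%N].
    exists j; apply/qP => i /(complete_exponents hb cq).
    by have := hb i; lia.
  exists (Ordinal hr); apply/qP => i _.
  by have := hb i; have := b_le1 i; lia.
- exact: one_power_normal b1.
Qed.
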